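(* Let $(V,\nu,\tau,\tau^* )$ be a PN space such that $\tau^*$ is Archimedean and $\nu_p\neq\varepsilon_\infty$ for every $p\in V$, and let $\{p_1,\dots,p_n\}$ be a linearly independent set of vectors in $V$. Then there exist a number $c\neq0$ and a probabilistic norm $\nu':\mathbb{R}\to\Delta^+$ on a real PN space $(\mathbb{R},\nu',\tau',\tau'^{*})$, where $\tau'^{*}$ is Archimedean and $\nu'_p\neq\varepsilon_\infty$ for all $p\in\mathbb{R}$, such that for every choice of real scalars $\alpha_1,\dots,\alpha_n$, $$\nu_{\alpha_1p_1+\cdots+\alpha_np_n}\le\nu'_{c(|\alpha_1|+\cdots+|\alpha_n|)}.$$
   Context: $\Delta^{+}$ is the set of functions $F:[-\infty,+\infty]\to[0,1]$ that are left-continuous on $\mathbb{R}$, nondecreasing, with $F(0)=0$ and $F(+\infty)=1$, ordered pointwise ($F\le G$ iff $F(x)\le G(x)$ for all $x$). $\varepsilon_0$ is the d.f. equal to $0$ for $x\le0$ and $1$ for $x>0$; $\varepsilon_\infty$ is the d.f. equal to $0$ on all of $\mathbb{R}$ (and $1$ at $+\infty$). A triangle function is a map $\tau:\Delta^+\times\Delta^+\to\Delta^+$ that is associative, commutative, nondecreasing in each argument, with unit $\varepsilon_0$; it is Archimedean if its only idempotents (elements $F$ with $\tau(F,F)=F$) are $\varepsilon_0$ and $\varepsilon_\infty$. A PN space is a quadruple $(V,\nu,\tau,\tau^* )$ with $V$ a real vector space, $\tau\le\tau^*$ continuous triangle functions, and $\nu:V\to\Delta^+$ such that for all $p,q\in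 V$: (N1) $\nu_p=\varepsilon_0$ iff $p=\theta$; (N2) $\nu_{-p}=\nu_p$; (N3) $\nu_{p+q}\ge\tau(\nu_p,\nu_q)$; (N4) $\nu_p\le\tau^*(\nu_{\lambda p},\nu_{(1-\lambda)p})$ for all $\lambda\in[0,1]$. *)

(* Defs.v *)
From HB Require Import structures.
From mathcomp Require Import all_boot all_order all_algebra.
From mathcomp Require Import all_classical all_reals all_analysis.
Set Implicit Arguments. Unset Strict Implicit. Unset Printing Implicit Defensive.
Import Order.TTheory GRing.Theory Num.Theory.
Import numFieldNormedType.Exports.
Local Open Scope classical_set_scope.
Local Open Scope ring_scope.

Section PN.
Variable R : realType.

(* A distance distribution function F : [-oo,+oo] -> [0,1] is represented by its
   restriction to the real line; the values F(-oo) = 0 and F(+oo) = 1 are fixed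
   by the definition of Delta^+ and therefore carry no information. *)
Definition dfun := R -> R.

Definition in_Delta (F : dfun) : Prop :=
  [/\ forall x, 0 <= F x <= 1,
      {homo F : x y / x <= y},
      forall x, F @ x^'- --> F x &
      F 0 = 0 ].

Definition eps0 : dfun := fun x => if 0 < x then 1 else 0.
Definition epsinf : dfun := fun _ => 0.

Definition dle (F G : dfun) : Prop := forall x, F x <= G x.

Definition weak_cvg (Fs : nat -> dfun) (F : dfun) : Prop :=
  forall x, {for x, continuous F} -> (fun n => Fs n x) @ \oo --> F x.

Definition triangle_function (tau : dfun -> dfun -> dfun) : Prop :=
  [/\ forall F G, in_Delta F -> in_Delta G -> in_Delta (tau F G),
      forall F G H, in_Delta F -> in_Delta G -> in_Delta H ->
        tau F (tau G H) = tau (tau F G) H,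
      forall F G, in_Delta F -> in_Delta G -> tau F G = tau G F,
      forall F F' G, in_Delta F -> in_Delta F' -> in_Delta G ->
        dle F F' -> dle (tau F G) (tau F' G) &
      forall F, in_Delta F -> tau F eps0 = F ].

(* continuity of tau on Delta^+ x Delta^+ for the (metrizable) topology of
   weak convergence, expressed sequentially *)
Definition tf_continuous (tau : dfun -> dfun -> dfun) : Prop :=
  forall (Fs Gs : nat -> dfun) F G,
    (forall n, in_Delta (Fs n)) -> (forall n, in_Delta (Gs n)) ->
    in_Delta F -> in_Delta G ->
    weak_cvg Fs F -> weak_cvg Gs G -> weak_cvg (fun n => tau (Fs n) (Gs n)) (tau F G).

Definition archimedean_tf (tau : dfun -> dfun -> dfun) : Prop :=
  forall F, in_Delta F -> tau F F = F -> F = eps0 \/ F = epsinf.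

Definition PN_space (V : lmodType R) (nu : V -> dfun)
  (tau taus : dfun -> dfun -> dfun) : Prop :=
  [/\ triangle_function tau /\ triangle_function taus,
      tf_continuous tau /\ tf_continuous taus,
      (forall F G, in_Delta F -> in_Delta G -> dle (tau F G) (taus F G)),
      (forall p, in_Delta (nu p)) &
      [/\ forall p, nu p = eps0 <-> p = 0,
          forall p, nu (- p) = nu p,
          forall p q, dle (tau (nu p) (nu q)) (nu (p + q)) &
          forall p (l : R), 0 <= l <= 1 ->
            dle (nu p) (taus (nu (l *: p)) (nu ((1 - l) *: p)))]].

Definition lin_indep (V : lmodType R) (n : nat) (p : 'I_n -> V) : Prop :=
  forall a : 'I_n -> R, \sum_(i < n) a i *: p i = 0 -> forall i, a i = 0.

End PN.

(* Main.v *)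
(* Let S(t) be the set of combinations of the p_i with sum |alpha_i| = t. Scaling
   by 1/2 in (N4) together with the Archimedean property of taus shows that
   nu (s p) tends to eps0 as s -> 0 and to epsinf as s -> oo (p <> 0). Compactness
   of the l1-sphere then yields, for every t > 0, some x > 0 with
   nu_v(x) <= exp(-x) on S(t), and, for every x > 0, some t with the same property.
   A 1-Lipschitz regularization of these bounds gives an increasing bijection h
   with h 0 = 0 and nu_v(h t) <= exp(-h t) for v in S(t).

   On the real line the norms exp(-max(0, |t| - x)) form a PN space for the
   sup-convolution tauP of the product t-norm, which is continuous and
   Archimedean; (N3) and (N4) both hold with tau' = taus' = tauP. Conjugating
   arguments by h and values by v |-> exp(-h(-ln v)) turns these norms into
   nu'_t(x) = exp(-h(max(0, |t| - h^-1 x))), which dominates nu on S(t) because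
   nu_v(x) <= nu_v(h t) <= exp(-h t) when x < h t. Hence c = 1 works. *)
Require Import Defs.
From HB Require Import structures.
From mathcomp Require Import all_boot all_order all_algebra.
From mathcomp Require Import all_classical all_reals all_analysis.
From mathcomp Require Import ring lra.
Import Order.TTheory GRing.Theory Num.Theory.
Import numFieldNormedType.Exports.
Local Open Scope classical_set_scope.
Local Open Scope ring_scope.
Set Implicit Arguments. Unset Strict Implicit. Unset Printing Implicit Defensive.

(** * Distance distribution functions and weak convergence in terms of tolerances *)

Section DistanceDistributions.
Context {R : realType}.
Implicit Types (F G H : dfun R) (Fs Gs : nat -> dfun R) (x y e a b c : R).

(** For monotone F the values on [y, x] lie between [F y] and [F x], so one good point y per
    tolerance settles the left limit. *)
Lemma left_cvgP F x : {homo F : x y / x <= y} ->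
  F @ x^'- --> F x <-> forall e, 0 < e -> exists2 y, y < x & F x - e < F y.
Proof.
move=> ndF; split=> [Fx e e0|Fx].
  have Hx : \forall y \near x^'-, y < x by exact: nbhs_left_lt.
  move/cvgrPdist_lt : Fx => /(_ _ e0) Fx.
  have [y [yx /=]] := filter_ex (filterI Hx Fx).
  by rewrite ltr_norml => /andP[_ ?]; exists y => //; lra.
apply/cvgrPdist_lt => e /Fx[y yx Fy].
near=> z.
have zx : z < x by near: z; exact: nbhs_left_lt.
have yz : y <= z by near: z; exact: nbhs_left_ge.
have := ndF _ _ yz; have := ndF _ _ (ltW zx).
by rewrite ltr_norml => ? ?; apply/andP; split; lra.
Unshelve. all: by end_near. Qed.

Lemma in_DeltaP F : in_Delta F <->
  [/\ forall x, 0 <= F x <= 1, {homo F : x y / x <= y},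
      forall x e, 0 < e -> exists2 y, y < x & F x - e < F y & F 0 = 0].
Proof.
by split=> -[F01 ndF lcF F0]; split => // x; exact/(left_cvgP x ndF)/lcF.
Qed.

Section InDelta.
Variables (F : dfun R) (DF : in_Delta F).

Lemma Delta_ge0 x : 0 <= F x.
Proof. by case: DF => /(_ x)/andP[]. Qed.

Lemma Delta_le1 x : F x <= 1.
Proof. by case: DF => /(_ x)/andP[]. Qed.

Lemma Delta_homo x y : x <= y -> F x <= F y.
Proof. by case: DF => _ + _ _; apply. Qed.

Lemma Delta_left x e : 0 < e -> exists2 y, y < x & F x - e < F y.
Proof. by case/in_DeltaP: DF => _ _ + _; apply. Qed.

Lemma Delta_le0 x : x <= 0 -> F x = 0.
Proof.
case: DF => _ _ _ F0 /Delta_homo Fx.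
by apply/le_anti; rewrite Delta_ge0 andbT -F0.
Qed.

Lemma Delta_le_eps0 : dle F (@eps0 R).
Proof.
move=> x; rewrite /eps0; case: ltP => x0; first exact: Delta_le1.
by rewrite Delta_le0.
Qed.

Lemma Delta_leP x c : (forall y, y < x -> F y <= c) -> F x <= c.
Proof.
move=> Fc; apply/ler_addgt0Pr => e e0.
by have [y /Fc yc Fy] := Delta_left x e0; lra.
Qed.

(** Left continuity is part of [in_Delta]; on the right, one point per tolerance suffices by
    monotonicity. *)
Lemma Delta_continuousP x : {for x, continuous F} <->
  forall e, 0 < e -> exists2 y, x < y & F y < F x + e.
Proof.
split=> [Fx e e0|Fx].
  have Hx : \forall y \near x^'+, x < y by exact: nbhs_right_gt.
  have {}Fx : F @ x^'+ --> F x by apply: cvg_at_right_filter.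
  move/cvgrPdist_lt : Fx => /(_ _ e0) Fx.
  have [y [yx /=]] := filter_ex (filterI Hx Fx).
  by rewrite ltr_norml => /andP[? _]; exists y => //; lra.
apply/cvgrPdist_lt => e e0.
have [y xy Fy] := Fx _ e0; have [z zx Fz] := Delta_left x e0.
near=> t.
have ty : t <= y by near: t; have := lt_nbhsl xy; apply: filterS => u /ltW.
have zt : z <= t by near: t; have := lt_nbhsr zx; apply: filterS => u /ltW.
have := Delta_homo ty; have := Delta_homo zt.
by rewrite ltr_norml => ? ?; apply/andP; split; lra.
Unshelve. all: by end_near. Qed.

(** A monotone function has only countably many discontinuities, while ]a, b[ has positive Lebesgue
    measure. *)
Lemma Delta_continuity_point a b : a < b ->
  exists2 x, a < x < b & {for x, continuous F}.
Proof.
move=> ab; apply: contrapT => noF.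
have ndF : {in `[a, b] &, nondecreasing_fun F}.
  by move=> u v _ _; exact: Delta_homo.
have := @discontinuity_countable R a b F ndF.
rewrite (_ : [set x | _] = [set` `]a, b[]); last first.
  apply/seteqP; split=> x /=; first by case.
  move=> xab; split => //; split.
  - case: DF => _ _ + _ => /(_ x) Fx; apply/cvg_ex; exists (F x); exact: Fx.
  - apply: nondecreasing_at_right_is_cvgr.
      by near=> z => u v _ _; exact: Delta_homo.
    by near=> z; exists 0 => _ [u _ <-]; exact: Delta_ge0.
  (* If the one-sided limits at x agreed, left continuity would equate both with [F x] and make x a
     continuity point. *)
  apply: contra_notN noF => /eqP lr.
  exists x; first by move: xab; rewrite in_itv.
  apply/left_right_continuousP; split; first by case: DF.
  have <- : lim (F u @[u --> x^'-]) = F x.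
    by apply: cvg_lim => //; case: DF.
  rewrite lr; apply: nondecreasing_at_right_is_cvgr.
    by near=> z => u v _ _; exact: Delta_homo.
  by near=> z; exists 0 => _ [u _ <-]; exact: Delta_ge0.
move/countable_lebesgue_measure0.
rewrite lebesgue_measure_itv/= lte_fin ab -EFinB => -[] /eqP.
by rewrite subr_eq0 gt_eqF.
Unshelve. all: by end_near. Qed.

End InDelta.

Lemma eps0_in_Delta : in_Delta (@eps0 R).
Proof.
apply/in_DeltaP; split=> [x|x y xy|x e e0|]; rewrite /eps0 ?ltxx//.
- by case: ifP; rewrite ?lexx ?ler01.
- by case: ltP => // x0; rewrite ?(lt_le_trans x0)//; case: ifP.
- case: ltP => x0.
    by exists (x / 2); [lra|rewrite divr_gt0//; lra].
  by exists (x - 1); [lra|case: ifP => _; lra].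
Qed.

Lemma dle_anti F G : dle F G -> dle G F -> F = G.
Proof. by move=> FG GF; apply/funext => x; apply/le_anti; rewrite FG GF. Qed.

(* As for the Levy metric, the discontinuities of the limit play no role. *)
Lemma weak_cvgP Fs F : (forall n, in_Delta (Fs n)) -> in_Delta F ->
  weak_cvg Fs F <-> forall x y e, x < y -> 0 < e ->
    \forall n \near \oo, Fs n x < F y + e /\ F x - e < Fs n y.
Proof.
move=> DFs DF; split=> [FsF x y e xy e0|FsF x].
  have [z /andP[xz zy] /FsF/cvgrPdist_lt/(_ _ e0)] :=
    Delta_continuity_point DF xy.
  apply: filterS => n; rewrite ltr_norml => /andP[? ?].
  have := Delta_homo (DFs n) (ltW xz); have := Delta_homo (DFs n) (ltW zy).
  have := Delta_homo DF (ltW xz); have := Delta_homo DF (ltW zy).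
  by split; lra.
move=> /(Delta_continuousP DF) Fx; apply/cvgrPdist_lt => e e0.
have e20 : 0 < e / 2 by lra.
have [y xy Fy] := Fx _ e20; have [z zx Fz] := Delta_left DF x e20.
apply: filterS2 (FsF _ _ _ xy e20) (FsF _ _ _ zx e20) => n [? _] [_ ?].
by rewrite ltr_norml; apply/andP; split; lra.
Qed.

End DistanceDistributions.

(** * Sup-convolution for the product t-norm *)

Section SupConvolution.
Context {R : realType}.
Implicit Types (F G H : dfun R) (Fs Gs : nat -> dfun R) (x y s u c e t : R).

(** Letting s run over the whole line is harmless: on Delta^+ the product vanishes outside 0 < s <
    x. *)
Definition tauP F G : dfun R :=
  fun x => sup (range (fun s => F s * G (x - s))).

Lemma tauP_le F G x c : (forall s u, s + u = x -> F s * G u <= c) ->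
  tauP F G x <= c.
Proof.
move=> FGc; apply: ge_sup; first by exists (F 0 * G (x - 0)); exists 0.
by move=> _ [s _ <-]; apply: FGc; rewrite subrKC.
Qed.

Section InDelta.
Variables (F G : dfun R) (DF : in_Delta F) (DG : in_Delta G).

Lemma mul_Delta_le1 s u : F s * G u <= 1.
Proof.
by rewrite mulr_ile1 ?(Delta_ge0 DF) ?(Delta_ge0 DG) ?(Delta_le1 DF)
  ?(Delta_le1 DG).
Qed.

Let hub x : has_ubound (range (fun s => F s * G (x - s))).
Proof. by exists 1 => _ [s _ <-]; exact: mul_Delta_le1. Qed.

Lemma tauP_ge s u : F s * G u <= tauP F G (s + u).
Proof.
by apply: (ub_le_sup (hub _)); exists s => //; rewrite addrC addKr.
Qed.

Lemma tauP_adherent x e : 0 < e ->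
  exists s u, s + u = x /\ tauP F G x - e < F s * G u.
Proof.
move=> e0; have hs : has_sup (range (fun s => F s * G (x - s))).
  by split => //; exists (F 0 * G (x - 0)); exists 0.
have [_ [s _ <-] se] := sup_adherent e0 hs.
by exists s, (x - s); split; [rewrite subrKC|].
Qed.

(** Pulls a factor under the supremum, for the iterated suprema in [tauPA]. When k = 0, the pair (x,
    0) supplies 0 <= c. *)
Lemma mul_tauP_le k x c : 0 <= k ->
  (forall s u, s + u = x -> k * (F s * G u) <= c) -> k * tauP F G x <= c.
Proof.
rewrite le_eqVlt => /predU1P[<-|k0 kc].
  by move=> /(_ x 0 (addr0 _)); rewrite !mul0r.
rewrite -ler_pdivlMl//; apply: tauP_le => s u /kc.
by rewrite ler_pdivlMl.
Qed.

Lemma tauP_in_Delta : in_Delta (tauP F G).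
Proof.
have ge0 x : 0 <= tauP F G x.
  rewrite -(subrKC 0 x); apply: le_trans (tauP_ge _ _).
  by rewrite mulr_ge0 ?(Delta_ge0 DF) ?(Delta_ge0 DG).
have nd : {homo tauP F G : x y / x <= y}.
  move=> x y xy; apply: tauP_le => s u sux.
  apply: (@le_trans _ _ (F s * G (y - s))).
    rewrite ler_wpM2l ?(Delta_ge0 DF)//; apply: (Delta_homo DG); lra.
  by have := tauP_ge s (y - s); rewrite subrKC.
apply/in_DeltaP; split => //.
- move=> x; rewrite ge0/=; apply: tauP_le => s u _; exact: mul_Delta_le1.
(* Left continuity: in a nearly optimal pair (s, u) only u is lowered, and the loss is at most that
   of G because [F s <= 1]. *)
- move=> x e e0; have e20 : 0 < e / 2 by lra.
  have [s [u [<- su]]] := tauP_adherent x e20.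
  have [v vu Gv] := Delta_left DG u e20.
  exists (s + v); first by lra.
  have := tauP_ge s v.
  have := Delta_ge0 DF s; have := Delta_le1 DF s.
  by nra.
- apply/le_anti; rewrite ge0 andbT; apply: tauP_le => s u su.
  have [s0|s0] := leP s 0; first by rewrite (Delta_le0 DF s0) mul0r.
  by rewrite (@Delta_le0 _ G)// ?mulr0//; lra.
Qed.

Lemma tauPC : tauP F G = tauP G F.
Proof.
apply: dle_anti => x; apply: tauP_le => s u <-.
  by rewrite mulrC addrC; apply: le_trans (ub_le_sup _ _); [exact: lexx| |];
    [exists 1 => _ [v _ <-]; rewrite mulrC mul_Delta_le1|
     exists u => //; rewrite addrC addrK].
by rewrite mulrC addrC tauP_ge.
Qed.

End InDelta.

(** Both sides are the supremum of the triple products over decompositions of x into three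
    summands. *)
Lemma tauPA F G H : in_Delta F -> in_Delta G -> in_Delta H ->
  tauP F (tauP G H) = tauP (tauP F G) H.
Proof.
move=> DF DG DH; have DFG := tauP_in_Delta DF DG.
have DGH := tauP_in_Delta DG DH.
apply: dle_anti => x; apply: tauP_le => s u sux.
  apply: mul_tauP_le => [|v w vwu]; first exact: Delta_ge0.
  rewrite mulrA; apply: (@le_trans _ _ (tauP F G (s + v) * H w)).
    by rewrite ler_wpM2r ?tauP_ge ?(Delta_ge0 DH).
  by rewrite -sux -vwu addrA tauP_ge.
rewrite mulrC; apply: mul_tauP_le => [|v w vwu]; first exact: Delta_ge0.
rewrite mulrC -mulrA; apply: (@le_trans _ _ (F v * tauP G H (w + u))).
  by rewrite ler_wpM2l ?tauP_ge ?(Delta_ge0 DF).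
by rewrite -sux -vwu -addrA tauP_ge.
Qed.

(** The factor [eps0] restricts the supremum to s < x, which leaves the left limit of F at x. *)
Lemma tauP_eps0 F : in_Delta F -> tauP F (@eps0 R) = F.
Proof.
move=> DF; apply: dle_anti => x.
  apply: tauP_le => s u <-; rewrite /eps0; case: ltP => u0.
    by rewrite mulr1 (Delta_homo DF)//; lra.
  by rewrite mulr0 (Delta_ge0 DF).
apply: (Delta_leP DF) => y yx.
have := tauP_ge DF eps0_in_Delta y (x - y).
by rewrite subrKC /eps0 subr_gt0 yx mulr1.
Qed.

Lemma tauP_triangle : triangle_function tauP.
Proof.
split; [exact: tauP_in_Delta|exact: tauPA|exact: tauPC| |exact: tauP_eps0].
move=> F F' G DF DF' DG FF' x; apply: tauP_le => s u <-.
by apply: le_trans (tauP_ge DF' DG s u); rewrite ler_wpM2r ?(Delta_ge0 DG).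
Qed.

Let mul_close a b a' b' e : 0 <= a <= 1 -> 0 <= b <= 1 -> 0 <= a' -> 0 <= b' ->
  0 < e <= 1 -> a' < a + e -> b' < b + e -> a' * b' < a * b + 3 * e.
Proof.
move=> /andP[a0 a1] /andP[b0 b1] a'0 b'0 /andP[e0 e1] ae be.
apply: (@le_lt_trans _ _ ((a + e) * b')); first by rewrite ler_wpM2r// ltW.
apply: (@lt_le_trans _ _ ((a + e) * (b + e))).
  by rewrite ltr_pM2l// ltr_wpDl.
rewrite mulrDl !mulrDr -addrA lerD2l.
have : a * e <= 1 * e by rewrite ler_pM2r.
have : e * b <= e * 1 by rewrite ler_pM2l.
have : e * e <= e * 1 by rewrite ler_pM2l.
by lra.
Qed.

(** By [weak_cvgP] there is slack between x and y. The lower estimate follows a single nearly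
    optimal pair; the upper one must be uniform in s, hence a finite cover. *)
Lemma tauP_continuous : tf_continuous tauP.
Proof.
move=> Fs Gs F G DFs DGs DF DG /(weak_cvgP DFs DF) FsF /(weak_cvgP DGs DG) GsG.
apply/weak_cvgP => [n||x y e xy e0]; [exact: tauP_in_Delta..|].
pose e' := Num.min 1 (e / 4).
have e'1 : 0 < e' <= 1.
  by rewrite /e' lt_min ltr01 ge_min lexx/=; rewrite andbT; lra.
have e'0 : 0 < e' by case/andP: e'1.
have e'e : 3 * e' < e by have : e' <= e / 4 by [rewrite /e' ge_min lexx orbT]; lra.
have D01 H v : in_Delta H -> 0 <= H v <= 1 by case.
have D0 H v : in_Delta H -> 0 <= H v by move=> DH; exact: Delta_ge0.
have e''0 : 0 < e - 3 * e' by lra.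
(* A cell contributes its width d, and weak convergence shifts each of the two arguments by another
   d: the total is exactly x + 3d = y. *)
pose d := (y - x) / 3.
have d0 : 0 < d by rewrite /d; lra.
(* Only 0 < s < x contributes to the supremum at x, and [0, x] is covered by
   N cells of width d, on each of which the product is bounded by its values at
   the endpoints of the cell. *)
pose N := (Num.truncn (x / d)).+1.
have xN : x < N%:R * d by rewrite -ltr_pdivrMr// truncnS_gt.
near=> n; split; last first.
  near: n.
  have [s [u [sux su]]] := tauP_adherent DF DG x e''0.
  have sd : s < s + (y - x) / 2 by lra.
  have ud : u < u + (y - x) / 2 by lra.
  apply: filterS2 (FsF _ _ _ sd e'0) (GsG _ _ _ ud e'0) => n [_ Fn] [_ Gn].
  have := tauP_ge (DFs n) (DGs n) (s + (y - x) / 2)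
    (u + (y - x) / 2).
  rewrite (_ : s + _ + (u + _) = y); last by lra.
  rewrite ltrBlDr in Fn; rewrite ltrBlDr in Gn.
  have := mul_close (D01 _ _ (DFs n)) (D01 _ _ (DGs n)) (D0 _ _ DF) (D0 _ _ DG)
    e'1 Fn Gn.
  by lra.
have cells : forall i : 'I_N,
  Fs n (i.+1%:R * d) * Gs n (x - i%:R * d) < tauP F G y + 3 * e'.
  near: n; apply: filter_forall => i.
  have Fd : i.+1%:R * d < i.+1%:R * d + d by lra.
  have Gd : x - i%:R * d < x - i%:R * d + d by lra.
  apply: filterS2 (FsF _ _ _ Fd e'0) (GsG _ _ _ Gd e'0) => n [Fn _] [Gn _].
  have := mul_close (D01 _ _ DF) (D01 _ _ DG) (D0 _ _ (DFs n)) (D0 _ _ (DGs n))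
    e'1 Fn Gn.
  move/lt_le_trans; apply; rewrite lerD2r.
  have := tauP_ge DF DG (i.+1%:R * d + d) (x - i%:R * d + d).
  rewrite (_ : _ + d + _ = y)//.
  by rewrite -natr1 /d; lra.
apply: (@le_lt_trans _ _ (tauP F G y + 3 * e')); last by rewrite ltrD2l.
have H0 : 0 <= tauP F G y + 3 * e'.
  by rewrite addr_ge0 ?(Delta_ge0 (tauP_in_Delta DF DG))// mulr_ge0// ltW.
apply: tauP_le => s u sux.
have [s0|s0] := leP s 0; first by rewrite (Delta_le0 (DFs n) s0) mul0r.
have [u0|u0] := leP u 0; first by rewrite (Delta_le0 (DGs n) u0) mulr0.
have sd0 : 0 <= s / d by rewrite divr_ge0// ltW.
have /andP[ile ltS] := truncn_itv sd0.
have iN : (Num.truncn (s / d) < N)%N.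
  rewrite -(ltr_nat R); apply: (le_lt_trans ile).
  by rewrite ltr_pdivrMr// (lt_trans _ xN)// -sux ltrDl.
apply/ltW; apply: le_lt_trans (cells (Ordinal iN)) => /=.
apply: ler_pM; rewrite ?D0//.
  by apply: (Delta_homo (DFs n)); rewrite -ler_pdivrMr// ltW.
apply: (Delta_homo (DGs n)).
by move: ile; rewrite ler_pdivlMr// => ile; rewrite -sux lerBrDr addrC lerD2r.
Unshelve. all: by end_near. Qed.

(** When s + u = x with s, u > 0, one of them is at most x / 2 and the other at most x. Idempotency
    thus gives F x <= F x * F (x / 2), so F (x / 2) = 1 as soon as F x is nonzero; halving
    repeatedly then reaches every y > 0. *)
Lemma tauP_archimedean : archimedean_tf tauP.
Proof.
move=> F DF FF.
have half x : F x != 0 -> F (x / 2) = 1.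
  move=> Fx0; have Fx : 0 < F x by rewrite lt_def Fx0 (Delta_ge0 DF).
  apply/le_anti; rewrite (Delta_le1 DF)/= -(ler_pM2l Fx) mulr1 -{1}FF.
  apply: tauP_le => s u sux.
  have [s0|s0] := leP s 0.
    by rewrite (Delta_le0 DF s0) mul0r mulr_ge0 ?(Delta_ge0 DF).
  have [u0|u0] := leP u 0.
    by rewrite (Delta_le0 DF u0) mulr0 mulr_ge0 ?(Delta_ge0 DF).
  have [sx|sx] := leP s (x / 2).
    by rewrite mulrC ler_pM ?(Delta_ge0 DF)//; apply: (Delta_homo DF); lra.
  by rewrite ler_pM ?(Delta_ge0 DF)//; apply: (Delta_homo DF); lra.
have [[x Fx]|noF] := pselect (exists x, F x != 0); [left|right]; last first.
  apply/funext => x; rewrite /epsinf; apply/eqP/negPn/negP => Fx.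
  by apply: noF; exists x.
have Fpow k : F (x / 2 ^+ k) != 0.
  elim: k => [|k IH]; first by rewrite expr0 divr1.
  by rewrite exprSr invfM mulrA half// oner_neq0.
apply/funext => y; rewrite /eps0; case: ltP => y0; last exact: Delta_le0.
have x0 : 0 < x by rewrite ltNge; apply: contra Fx => /(Delta_le0 DF) ->.
apply/le_anti; rewrite (Delta_le1 DF)/=.
(* This k gives x / y < k + 1 <= 2 ^ (k + 1), so k + 1 halvings bring x below y. *)
pose k := Num.truncn (x / y).
rewrite -(half _ (Fpow k)); apply: (Delta_homo DF).
rewrite -mulrA -invfM -exprSr ler_pdivrMr ?exprn_gt0//.
rewrite mulrC -ler_pdivrMr//; apply/ltW.
apply: (@lt_le_trans _ _ k.+1%:R); first exact: truncnS_gt.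
by rewrite -natrX ler_nat ltnW// ltn_expl.
Qed.

End SupConvolution.

(** * A model PN space on the real line *)

Section ExponentialNorm.
Context {R : realType}.
Implicit Types (t x y : R).

(** [R^o] is R as a vector space over itself. The value reaches 1 at x = |t|, and the test 0 < x
    enforces the vanishing required by Delta^+. *)
Definition exp_norm (t : R^o) : dfun R :=
  fun x => if 0 < x then expR (- Num.max 0 (`|t : R| - x)) else 0.

Lemma exp_norm_in_Delta t : in_Delta (exp_norm t).
Proof.
have nd : {homo exp_norm t : x y / x <= y}.
  move=> x y xy; rewrite /exp_norm; case: ltP => x0.
    rewrite (lt_le_trans x0 xy) ler_expR lerN2 ge_max le_max lexx/=.
    by rewrite le_max; apply/orP; right; lra.
  by case: ifP => // _; rewrite ltW// expR_gt0.
apply/in_DeltaP; split=> // [x|x e e0|]; rewrite /exp_norm ?ltxx//.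
- case: ifP; rewrite ?lexx ?ler01// ltW ?expR_gt0//= expR_le1 oppr_le0.
  by rewrite le_max lexx.
- case: ltP => x0; last first.
    exists (x - 1); first lra.
    by rewrite ifF ?sub0r ?oppr_lt0//; apply/negbTE; rewrite -leNgt; lra.
  (* The bound x / 2 keeps x - m positive; by expR (- m) >= 1 - m, the bound e / 2 keeps the loss
     below e. *)
  set m := Num.min (e / 2) (x / 2).
  have m0 : 0 < m by rewrite /m lt_min; apply/andP; split; lra.
  have [me mx] : m <= e / 2 /\ m <= x / 2.
    by rewrite /m !ge_min !lexx orbT.
  exists (x - m); first lra.
  rewrite (_ : 0 < x - m); last by lra.
  set a := Num.max _ _; set b := Num.max _ _.
  have a0 : 0 <= a by rewrite /a le_max lexx.
  have ba : b <= a + m.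
    rewrite /b ge_max; apply/andP; split; first lra.
    by rewrite -lerBlDr /a le_max; apply/orP; right; lra.
  have : expR (- a) * (1 - m) <= expR (- a) * expR (- m).
    by rewrite ler_pM2l ?expR_gt0// expR_ge1Dx.
  rewrite -expRD => H1.
  have : expR (- a - m) <= expR (- b) by rewrite ler_expR; lra.
  have : expR (- a) * m <= 1 * m by rewrite ler_pM2r// expR_le1 oppr_le0.
  by lra.
Qed.

Lemma exp_norm0 : exp_norm 0 = @eps0 R.
Proof.
apply/funext => x; rewrite /exp_norm /eps0; case: ltP => // x0.
by rewrite normr0 max_l ?oppr0 ?expR0//; lra.
Qed.

Lemma exp_norm_eps0 t : exp_norm t = @eps0 R <-> t = 0.
Proof.
split=> [tE|->]; last exact: exp_norm0.
apply/eqP; rewrite -normr_le0 leNgt; apply/negP => t0.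
have := congr1 (fun F : dfun R => F (`|t| / 2)) tE.
rewrite /exp_norm /eps0 divr_gt0// max_r; last by lra.
by apply/eqP; rewrite lt_eqF// expR_lt1; lra.
Qed.

Lemma exp_norm_neq_epsinf t : exp_norm t <> @epsinf R.
Proof.
move=> /(congr1 (fun F : dfun R => F 1)); rewrite /exp_norm /epsinf ltr01.
by apply/eqP; rewrite gt_eqF// expR_gt0.
Qed.

(** Products of exponentials add the exponents. (N3) is then subadditivity of max(0, |p| - s) in (p,
    s), and (N4) follows by splitting x as l x + (1 - l) x, by homogeneity of the same
    expression. *)
Lemma exp_norm_PN_space : PN_space exp_norm tauP tauP.
Proof.
split; [by split; exact: tauP_triangle|by split; exact: tauP_continuous|
  by move=> F G _ _ x; exact: lexx|exact: exp_norm_in_Delta|split].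
- exact: exp_norm_eps0.
- by move=> t; rewrite /exp_norm normrN.
- move=> p q x; apply: tauP_le => s u <-; rewrite /exp_norm.
  have [s0|s0] := ltP 0 s; last first.
    by rewrite mul0r; case: ifP => // _; rewrite ltW// expR_gt0.
  have [u0|u0] := ltP 0 u; last first.
    by rewrite mulr0; case: ifP => // _; rewrite ltW// expR_gt0.
  rewrite addr_gt0// -expRD ler_expR -opprD lerN2 ge_max.
  rewrite addr_ge0 ?le_max ?lexx//=.
  apply: (@le_trans _ _ ((`|p| - s) + (`|q| - u))).
    by have := ler_normD p q; rewrite /=; lra.
  by rewrite lerD// le_max lexx orbT.
move=> p l /andP[l0 l1] x.
have D := exp_norm_in_Delta.
(* The endpoints are separate: there l x or (1 - l) x would be 0, where every distribution function
   vanishes. *)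
have [->|l0'] := eqVneq l 0.
  rewrite scale0r subr0 scale1r exp_norm0 tauPC ?tauP_eps0//.
  exact: eps0_in_Delta.
have [->|l1'] := eqVneq l 1.
  by rewrite scale1r subrr scale0r exp_norm0 tauP_eps0.
have lp : 0 < l by rewrite lt_def l0'.
have l1p : 0 < 1 - l by rewrite subr_gt0 lt_def eq_sym l1'.
have [x0|x0] := ltP 0 x; last first.
  by rewrite (Delta_le0 (D _) x0) (Delta_ge0 (tauP_in_Delta (D _) (D _))).
have := tauP_ge (D (l *: p)) (D ((1 - l) *: p)) (l * x) ((1 - l) * x).
rewrite -mulrDl subrKC mul1r; apply: le_trans.
rewrite /exp_norm x0 !mulr_gt0// -expRD ler_expR -opprD lerN2.
rewrite !normrM (gtr0_norm lp) (gtr0_norm l1p) -!mulrBr.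
have mz k z : 0 < k -> Num.max 0 (k * z) = k * Num.max 0 z.
  by move=> k0; rewrite maxr_pMr ?mulr0// ltW.
by rewrite !mz// -mulrDl subrKC mul1r.
Qed.

End ExponentialNorm.

(** * Change of variables in values and arguments *)

Section Transport.
Context {R : realType}.
Implicit Types (F G H : dfun R) (Fs Gs : nat -> dfun R) (x y e : R).

Definition increasing_bijection (f g : R -> R) :=
  [/\ cancel f g, cancel g f & {mono f : x y / x <= y}].

Lemma increasing_bijectionC f g :
  increasing_bijection f g -> increasing_bijection g f.
Proof.
by move=> [fK gK fm]; split => // x y; rewrite -fm !gK.
Qed.

Lemma increasing_bijection_continuous f g :
  increasing_bijection f g -> continuous f.
Proof.
move=> [fK gK fm] x; have fl := leW_mono fm.
apply/cvgrPdist_lt => e e0.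
have lx : g (f x - e) < x by rewrite -fl gK; lra.
have rx : x < g (f x + e) by rewrite -fl gK; lra.
apply: filterS2 (lt_nbhsl rx) (lt_nbhsr lx) => y.
rewrite -fl gK => ?; rewrite -fl gK => ?.
by rewrite ltr_norml; apply/andP; split; lra.
Qed.

Definition transport (f h : R -> R) F : dfun R := fun x => f (F (h x)).

Section Fixed.
Variables (f g h k : R -> R).
Hypotheses (fg : increasing_bijection f g) (hk : increasing_bijection h k).

Lemma transportK F : transport g k (transport f h F) = F.
Proof.
by apply/funext => x; rewrite /transport; case: fg => -> _ _; case: hk => _ -> _.
Qed.

Lemma transport_dle F G : dle F G -> dle (transport f h F) (transport f h G).
Proof. by case: fg => _ _ fm FG x; rewrite /transport fm. Qed.

(** Continuity of the transported limit at x gives continuity of F at [h x], since F is recovered by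
    the continuous inverses g and k. *)
Lemma weak_cvg_transport Fs F : weak_cvg Fs F ->
  weak_cvg (fun n => transport f h (Fs n)) (transport f h F).
Proof.
move=> FsF x Fx; have fc := increasing_bijection_continuous fg.
have gc := increasing_bijection_continuous (increasing_bijectionC fg).
have kc := increasing_bijection_continuous (increasing_bijectionC hk).
apply: (cvg_comp (fun n => Fs n (h x)) f _ (fc _)); apply: FsF.
rewrite -(transportK F) /prop_for /continuous_at /transport.
apply: (cvg_comp _ g _ (gc _)).
apply: (cvg_comp k (transport f h F) (kc _)).
by case: hk => -> _ _; exact: Fx.
Qed.

Hypotheses (f0 : f 0 = 0) (f1 : f 1 = 1) (h0 : h 0 = 0).

Lemma transport_in_Delta F : in_Delta F -> in_Delta (transport f h F).
Proof.
move=> DF; have [fK gK fm] := fg; have [hK kK hm] := hk.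
rewrite /transport; apply/in_DeltaP; split=> [x|x y xy|x e e0|].
- by apply/andP; split; [rewrite -f0|rewrite -f1];
    rewrite fm ?(Delta_ge0 DF) ?(Delta_le1 DF).
- by rewrite fm (Delta_homo DF)// hm.
(* The tolerance e, measured after f, is pulled back through g to a tolerance for F at [h x]. *)
- have le_e : 0 < F (h x) - g (f (F (h x)) - e).
    by rewrite subr_gt0 -(leW_mono fm) gK; lra.
  have [z zx Fz] := Delta_left DF (h x) le_e.
  exists (k z); first by rewrite -(leW_mono hm) kK.
  rewrite kK -(gK (f (F (h x)) - e)) (leW_mono fm).
  by rewrite opprB addrC subrK in Fz.
- by rewrite h0 (Delta_le0 DF)// f0.
Qed.

Lemma transport_eps0 : transport f h (@eps0 R) = @eps0 R.
Proof.
apply/funext => x; have [_ _ hm] := hk.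
rewrite /transport /eps0 -{1}h0 (leW_mono hm).
by case: ifP.
Qed.

Lemma transport_epsinf : transport f h (@epsinf R) = @epsinf R.
Proof. by apply/funext => x; rewrite /transport /epsinf f0. Qed.

End Fixed.

Section TriangleFunctions.
Variables (f g h k : R -> R).
Hypotheses (fg : increasing_bijection f g) (hk : increasing_bijection h k).
Hypotheses (f0 : f 0 = 0) (f1 : f 1 = 1) (h0 : h 0 = 0).

Let gf := increasing_bijectionC fg.
Let kh := increasing_bijectionC hk.
Let g0 : g 0 = 0. Proof. by case: fg => fK _ _; rewrite -{1}f0 fK. Qed.
Let g1 : g 1 = 1. Proof. by case: fg => fK _ _; rewrite -{1}f1 fK. Qed.
Let k0 : k 0 = 0. Proof. by case: hk => hK _ _; rewrite -{1}h0 hK. Qed.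
Let D F : in_Delta F -> in_Delta (transport f h F).
Proof. exact: (transport_in_Delta fg hk). Qed.
Let D' F : in_Delta F -> in_Delta (transport g k F).
Proof. exact: (transport_in_Delta gf kh). Qed.

(** The conjugate of [tau] by the order automorphism [transport f h] of Delta^+, so that the axioms
    carry over. *)
Definition transport_tf (tau : dfun R -> dfun R -> dfun R) F G :=
  transport f h (tau (transport g k F) (transport g k G)).

Lemma transport_triangle tau :
  triangle_function tau -> triangle_function (transport_tf tau).
Proof.
move=> [tD tA tC tm te]; rewrite /transport_tf; split.
- by move=> F G DF DG; apply/D/tD; exact: D'.
- move=> F G H DF DG DH.
  by rewrite !(transportK fg hk) tA//; exact: D'.
- by move=> F G DF DG; rewrite tC//; exact: D'.
- move=> F F' G DF DF' DG FF'.
  apply: (transport_dle _ fg); apply: tm; [exact: D'..|].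
  exact: (transport_dle _ gf).
- move=> F DF; rewrite (transport_eps0 kh)// te; last exact: D'.
  by rewrite (transportK gf kh).
Qed.

Lemma transport_continuous tau :
  tf_continuous tau -> tf_continuous (transport_tf tau).
Proof.
move=> tc Fs Gs F G DFs DGs DF DG FsF GsG.
apply: (weak_cvg_transport fg hk); apply: tc.
- by move=> n; exact: D'.
- by move=> n; exact: D'.
- exact: D'.
- exact: D'.
- exact: (weak_cvg_transport gf kh).
- exact: (weak_cvg_transport gf kh).
Qed.

Lemma transport_archimedean tau :
  archimedean_tf tau -> archimedean_tf (transport_tf tau).
Proof.
move=> ta F DF /(congr1 (transport g k)).
rewrite /transport_tf (transportK fg hk) => /ta[]; first exact: D'.
  move/(congr1 (transport f h)); rewrite (transportK gf kh).
  by rewrite (transport_eps0 hk)//; left.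
move/(congr1 (transport f h)); rewrite (transportK gf kh).
by rewrite transport_epsinf//; right.
Qed.

Lemma transport_PN_space (V : lmodType R) (nu : V -> dfun R) tau taus :
  PN_space nu tau taus ->
  PN_space (fun p => transport f h (nu p)) (transport_tf tau)
    (transport_tf taus).
Proof.
move=> [[tt ts] [ct cs] tts Dnu [N1 N2 N3 N4]]; split.
- by split; exact: transport_triangle.
- by split; exact: transport_continuous.
- by move=> F G DF DG; apply: (transport_dle _ fg); apply: tts; exact: D'.
- by move=> p; exact: D.
split.
- move=> p; split=> [|/N1 ->]; last by rewrite (transport_eps0 hk).
  move/(congr1 (transport g k)).
  by rewrite (transportK fg hk) (transport_eps0 kh)// => /N1.
- by move=> p; rewrite N2.
- move=> p q; rewrite /transport_tf !(transportK fg hk).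
  exact: (transport_dle _ fg).
- move=> p l l01; rewrite /transport_tf !(transportK fg hk).
  by apply: (transport_dle _ fg); exact: N4.
Qed.

End TriangleFunctions.

(** In the coordinate -ln v this map is h; the identity on v <= 0 extends it to a bijection of the
    whole line. *)
Definition exp_conj (h : R -> R) (v : R) :=
  if 0 < v then expR (- h (- ln v)) else v.

Lemma exp_conj0 h : exp_conj h 0 = 0.
Proof. by rewrite /exp_conj ltxx. Qed.

Lemma exp_conj1 h : h 0 = 0 -> exp_conj h 1 = 1.
Proof. by move=> h0; rewrite /exp_conj ltr01 ln1 oppr0 h0 oppr0 expR0. Qed.

Lemma exp_conj_gt0 h v : (0 < exp_conj h v) = (0 < v).
Proof. by rewrite /exp_conj; case: ifP => // _; rewrite expR_gt0. Qed.

Lemma exp_conj_expR h t : exp_conj h (expR (- t)) = expR (- h t).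
Proof. by rewrite /exp_conj expR_gt0 expRK opprK. Qed.

Lemma exp_conj_bijection h k :
  increasing_bijection h k -> increasing_bijection (exp_conj h) (exp_conj k).
Proof.
move=> [hK kK hm].
have can h' k' : cancel h' k' -> cancel (exp_conj h') (exp_conj k').
  move=> h'K v; have [v0|v0] := ltP 0 v.
    by rewrite {2}/exp_conj v0 exp_conj_expR h'K opprK lnK.
  by rewrite /exp_conj !(le_gtF v0).
have le0 u : u <= 0 -> exp_conj h u = u by move=> u0; rewrite /exp_conj le_gtF.
split; [exact: can..|] => v w.
have [v0|v0] := ltP 0 v; have [w0|w0] := ltP 0 w.
- rewrite /exp_conj v0 w0 ler_expR lerN2 hm lerN2.
  by rewrite ler_ln.
- rewrite (le0 _ w0) [RHS]leNgt (le_lt_trans w0 v0)/= leNgt.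
  by rewrite (le_lt_trans w0)// exp_conj_gt0.
- rewrite (le0 _ v0) (le_trans v0 (ltW w0)) (le_trans v0)// ltW//.
  by rewrite exp_conj_gt0.
- by rewrite !le0.
Qed.

End Transport.

(** * An increasing bijection below the threshold of a monotone relation *)

Section ScalingBijection.
Context {R : realType}.
Implicit Types (s t x y c r : R).
Variable P : R -> R -> Prop.
Hypothesis Pdown : forall t x y, 0 < t -> 0 <= x -> x <= y -> P t y -> P t x.
Hypothesis Pup : forall s t x, 0 < s -> s <= t -> 0 <= x -> P s x -> P t x.
Hypothesis Psmall : forall t, 0 < t -> exists2 x, 0 < x & P t x.
Hypothesis Plarge : forall x, 0 < x -> exists2 t, 0 < t & P t x.

(* The infimum of [envelope t] is the largest 1-Lipschitz minorant of
   t |-> sup {x | P t x} that vanishes at 0. *)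
Let envelope (t : R) : set R := [set r | exists s x,
  [/\ 0 <= s <= t, 0 <= x, r = x + (t - s) &
      (s = 0 /\ x = 0) \/ (0 < s /\ ~ P s x)]].
Let q0 t := inf (envelope t).

Let envelope_n0 t : 0 <= t -> envelope t !=set0.
Proof.
move=> t0; exists (0 + (t - 0)); exists 0, 0.
by split; rewrite ?lexx//; left.
Qed.

Let envelope_lb t : has_lbound (envelope t).
Proof. by exists 0 => _ [s [x [/andP[_ ?] ? -> _]]]; lra. Qed.

Let q0_le t r : envelope t r -> q0 t <= r.
Proof. exact: ge_inf. Qed.

Let q0_ge t c : 0 <= t ->
  (forall s x, 0 <= s <= t -> 0 <= x -> (s = 0 /\ x = 0) \/ (0 < s /\ ~ P s x) ->
    c <= x + (t - s)) -> c <= q0 t.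
Proof.
move=> t0 H; apply: lb_le_inf; first exact: envelope_n0.
by move=> _ [s [x [? ? -> ?]]]; exact: H.
Qed.

(** A competitor (s', x') with s' < s costs at least t - s; one with s <= s' inherits P at x, so its
    failure forces x < x'. *)
Let q0_ge_min s x t : 0 < s -> 0 <= x -> s <= t -> P s x ->
  Num.min x (t - s) <= q0 t.
Proof.
move=> s0 x0 st Psx; apply: q0_ge; first by lra.
move=> s' x' /andP[s'0 s't] x'0 H; rewrite ge_min.
have [ss'|s's] := leP s s'; last by apply/orP; right; lra.
case: H => [[]|[_ nP]]; first by lra.
apply/orP; left.
have [x'x|xx'] := leP x' x; last by lra.
by case: nP; apply: Pdown x'x _ => //; [lra|apply: Pup Psx].
Qed.

(** A competitor for t based at s' <= s is cheaper for s. If s' > s > 0, failure of P descends from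
    s' to s by [Pup], so (s, x') competes for s. *)
Let q0_homo s t : 0 <= s -> s <= t -> q0 s <= q0 t.
Proof.
move=> s0 st; apply: q0_ge; first by lra.
move=> s' x' /andP[s'0 s't] x'0 H.
have [s's|ss'] := leP s' s.
  apply: (@le_trans _ _ (x' + (s - s'))); last by lra.
  by apply: q0_le; exists s', x'; split => //; lra.
case: H => [[? _]|[_ nP]]; first by lra.
have [sp|sn] := ltP 0 s.
  apply: (@le_trans _ _ (x' + (s - s))); last by lra.
  apply: q0_le; exists s, x'; split => //; first by lra.
  by right; split => //; apply: contra_not nP => /Pup; apply => //; exact: ltW.
apply: (@le_trans _ _ (0 + (s - 0))); last by lra.
by apply: q0_le; exists 0, 0; split; rewrite ?lexx//; left.
Qed.

Let q0_lip s t : 0 <= s -> s <= t -> q0 t <= q0 s + (t - s).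
Proof.
move=> s0 st; rewrite -lerBlDr; apply: q0_ge => // s' x' /andP[? ?] ? ?.
have : q0 t <= x' + (t - s') by apply: q0_le; exists s', x'; split => //; lra.
by lra.
Qed.

Let q0_gt0 t : 0 < t -> 0 < q0 t.
Proof.
move=> t0; have t20 : 0 < t / 2 by lra.
have [x x0 Px] := Psmall t20.
have tt : t / 2 <= t by lra.
apply: lt_le_trans (q0_ge_min t20 (ltW x0) tt Px).
by rewrite lt_min x0/=; lra.
Qed.

(** If P failed at (t, x), this pair would compete at cost x and force q0 t <= x. *)
Let q0_P t x : 0 < t -> 0 <= x < q0 t -> P t x.
Proof.
move=> t0 /andP[x0 xq]; apply: contrapT => nP.
have : q0 t <= x + (t - t).
  by apply: q0_le; exists t, x; split => //; [lra|right].
by lra.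
Qed.

(** The factor t / (1 + t) makes the function strictly increasing and strictly smaller than [q0],
    where [q0_P] applies; the identity extends it to t <= 0. *)
Let q (t : R) : R := if 0 < t then q0 t * (t / (1 + t)) else t.

Let frac_lt s t : 0 <= s -> s < t -> s / (1 + s) < t / (1 + t).
Proof.
by move=> s0 st; rewrite ltr_pdivrMr; [rewrite mulrAC ltr_pdivlMr; nra|lra].
Qed.

Let q_mono : {mono q : s t / s <= t}.
Proof.
apply: le_mono => s t st; rewrite /q.
case: (ltP 0 s) => s0.
  have t0 : 0 < t by lra.
  rewrite t0.
  have := frac_lt (ltW s0) st.
  have := q0_gt0 s0; have := q0_homo (ltW s0) (ltW st) => q1 q2 fr.
  apply: (@lt_le_trans _ _ (q0 s * (t / (1 + t)))); first by rewrite ltr_pM2l.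
  by rewrite ler_wpM2r// divr_ge0//; lra.
case: (ltP 0 t) => t0; last by [].
by apply: (le_lt_trans s0); rewrite mulr_gt0 ?q0_gt0// divr_gt0//; lra.
Qed.

(** A product rule: on t >= 0, [q0] is 1-Lipschitz and at most t, while the fraction is 1-Lipschitz
    and at most 1. *)
Let q_lip s t : s <= t -> q t - q s <= (1 + `|t|) * (t - s).
Proof.
have q_pos u v : 0 <= u -> u <= v -> q v - q u <= (1 + v) * (v - u).
  move=> u0 uv; have [v0|v0] := ltP 0 v; last first.
    have -> : v = u by lra.
    by rewrite !subrr mulr0.
  have qE w : 0 <= w -> q w = q0 w * (w / (1 + w)).
    rewrite le_eqVlt => /predU1P[<-|w0]; first by rewrite /q ltxx mul0r mulr0.
    by rewrite /q w0.
  rewrite !qE//; last exact: ltW.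
  have q0u : q0 u <= u.
    have : q0 u <= 0 + (u - 0).
      by apply: q0_le; exists 0, 0; split; rewrite ?lexx//; left.
    by lra.
  have q0u0 : 0 <= q0 u by apply: q0_ge => // ? ? /andP[? ?] ? _; lra.
  have r1 : v / (1 + v) <= 1 by rewrite ler_pdivrMr; lra.
  have r0 : 0 <= v / (1 + v) by rewrite divr_ge0//; lra.
  have rr : v / (1 + v) - u / (1 + u) <= v - u.
    rewrite (_ : _ - _ = (v - u) / ((1 + v) * (1 + u))).
      rewrite ler_pdivrMr; last by rewrite mulr_gt0//; lra.
      by rewrite ler_peMr ?subr_ge0//; nra.
    by field; apply/andP; split; rewrite gt_eqF//; lra.
  have := q0_lip u0 uv; have := q0_homo u0 uv.
  move: (v / _) (u / _) r1 r0 rr => rv ru r1 r0 rr h1 h2.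
  have : (q0 v - q0 u) * rv <= (v - u) * 1 by rewrite ler_pM//; lra.
  have : q0 u * (rv - ru) <= v * (v - u).
    apply: (@le_trans _ _ (q0 u * (v - u))); first by rewrite ler_wpM2l.
    by rewrite ler_wpM2r//; lra.
  by lra.
move=> st; have [t0|t0] := leP t 0.
  rewrite /q !le_gtF//; last exact: le_trans t0.
  by have := normr_ge0 t; nra.
rewrite gtr0_norm//.
have [s0|s0] := leP 0 s; first exact: q_pos.
have := q_pos 0 t (lexx _) (ltW t0).
rewrite /q ltxx t0 (le_gtF (ltW s0)); nra.
Qed.

Let q_continuous : continuous q.
Proof.
move=> t; apply/cvgrPdist_lt => e e0.
have m0 : 0 < 2 + `|t| by have := normr_ge0 t; lra.
(* The cap 1 gives |u| <= |t| + 1, so 2 + |t| is a Lipschitz constant on both sides of t. *)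
have d0 : 0 < Num.min 1 (e / (2 + `|t|)) by rewrite lt_min ltr01 divr_gt0.
have := nbhsx_ballx t _ d0; apply: filterS => u; rewrite /ball/= lt_min.
move=> /andP[tu1]; rewrite ltr_pdivlMr// => tue.
apply: le_lt_trans tue; have [ut|/ltW tu] := leP u t.
  have qut : 0 <= q t - q u by rewrite subr_ge0 q_mono.
  have tu0 : 0 <= t - u by rewrite subr_ge0.
  rewrite (ger0_norm qut) (ger0_norm tu0); apply: (le_trans (q_lip ut)).
  by rewrite mulrC ler_wpM2l ?subr_ge0//; lra.
have qut : 0 <= q u - q t by rewrite subr_ge0 q_mono.
have tu0 : 0 <= u - t by rewrite subr_ge0.
rewrite distrC (ger0_norm qut); apply: (le_trans (q_lip tu)).
rewrite mulrC distrC (ger0_norm tu0) ler_wpM2l//.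
have : `|u| <= `|t| + `|t - u| by rewrite distrC -{1}(subrKC t u) ler_normD.
lra.
Qed.

Let q_surj y : exists t, q t = y.
Proof.
have [y0|y0] := ltP 0 y; last by exists y; rewrite /q le_gtF.
(* For t >= 1 the fraction is at least 1/2, so a value 2y + 1 of [q0] suffices; t = s + (2y + 1)
   makes both terms of the minimum in [q0_ge_min] that large. *)
have y20 : 0 < 2 * y + 1 by lra.
have [s s0 Ps] := Plarge y20.
pose t := s + (2 * y + 1).
have t1 : 1 <= t by rewrite /t; lra.
have t0 : 0 < t by lra.
have qt : 2 * y + 1 <= q0 t.
  have := q0_ge_min s0 (ltW y20) (_ : s <= t) Ps; rewrite /t minEle.
  by case: ifP => _ h; [apply: h; lra|apply: le_trans (h _); lra].
have qty : y <= q t.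
  rewrite /q t0.
  have : 1 / 2 <= t / (1 + t) by rewrite ler_pdivlMr; nra.
  by nra.
have q00 : q 0 = 0 by rewrite /q ltxx.
have [|c _ <-] := IVT (ltW t0) (continuous_subspaceT q_continuous) (v := y).
  by rewrite q00 ge_min le_max (ltW y0) qty orbT.
by exists c.
Qed.

Lemma scaling_bijection : exists h k, [/\ increasing_bijection h k, h 0 = 0 &
  forall t, 0 < t -> P t (h t)].
Proof.
have [k kK] := choice q_surj.
have qi : injective q by apply: (inc_inj q_mono).
exists q, k; split.
- by split => //; exact: (inj_can_sym kK qi).
- by rewrite /q ltxx.
move=> t t0; apply: q0_P => //; rewrite /q t0.
have := q0_gt0 t0 => q0t.
rewrite mulr_ge0 ?divr_ge0//=; [|lra..].
rewrite gtr_pMr// ltr_pdivrMr; lra.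
Qed.

End ScalingBijection.

(** * Weak convergence to eps0 and order properties of triangle functions *)

Section WeakConvergence.
Context {R : realType}.
Implicit Types (F G H : dfun R) (Fs Gs : nat -> dfun R) (x y c e : R).

Lemma weak_cvg_cst F : weak_cvg (fun=> F) F.
Proof. by move=> x _; exact: cvg_cst. Qed.

(** [eps0] is the greatest element of Delta^+, so the upper estimates are automatic. *)
Lemma weak_cvg_eps0P Fs : (forall n, in_Delta (Fs n)) ->
  weak_cvg Fs (@eps0 R) <->
  forall x e, 0 < x -> 0 < e -> \forall n \near \oo, 1 - e < Fs n x.
Proof.
move=> DFs; split=> [/(weak_cvgP DFs eps0_in_Delta) Fs0 x e x0 e0|Fs0].
  have x2 : x / 2 < x by lra.
  apply: filterS (Fs0 _ _ _ x2 e0) => n [_].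
  by rewrite /eps0 divr_gt0.
apply/(weak_cvgP DFs eps0_in_Delta) => x y e xy e0.
have le0 n : Fs n x < eps0 y + e.
  have := Delta_le_eps0 (DFs n) x.
  have := Delta_homo eps0_in_Delta (ltW xy); lra.
have [x0|x0] := ltP 0 x.
  have y0 : 0 < y by lra.
  apply: filterS (Fs0 _ _ y0 e0) => n Fny; split => //.
  by rewrite {1}/eps0 x0.
apply: nearW => n; split => //; rewrite /eps0 (le_gtF x0).
by have := Delta_ge0 (DFs n) y; lra.
Qed.

(** A single inequality [c <= F x] places this function below F, which makes monotonicity of
    triangle functions applicable. *)
Definition step_df (x c : R) : dfun R := fun z => if x < z then c else 0.

Lemma step_df_in_Delta x c : 0 <= x -> 0 <= c <= 1 -> in_Delta (step_df x c).
Proof.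
move=> x0 /andP[c0 c1]; apply/in_DeltaP; rewrite /step_df; split.
- by move=> z; case: ifP => _; rewrite ?lexx ?ler01 ?c0 ?c1.
- by move=> y z yz; case: ltP => xy; [rewrite (lt_le_trans xy yz)|case: ifP].
- move=> z e e0; case: ltP => xz.
    by exists ((x + z) / 2); [lra|rewrite ifT; lra].
  by exists (z - 1); [lra|rewrite ifF; [lra|apply/negbTE; rewrite -leNgt; lra]].
- by rewrite le_gtF.
Qed.

Section TriangleFunction.
Variables (tau : dfun R -> dfun R -> dfun R) (ttau : triangle_function tau).

Lemma tf_homo F F' G G' : in_Delta F -> in_Delta F' -> in_Delta G ->
  in_Delta G' -> dle F F' -> dle G G' -> dle (tau F G) (tau F' G').
Proof.
case: ttau => _ _ tC tm _ DF DF' DG DG' FF' GG' x.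
apply: (@le_trans _ _ (tau F' G x)); first exact: tm.
by rewrite tC// [leRHS](congr1 (@^~ x) (tC _ _ DF' DG')); exact: tm.
Qed.

(** The unit [eps0] is also the greatest element. *)
Lemma tf_le_left F G : in_Delta F -> in_Delta G -> dle (tau F G) F.
Proof.
move=> DF DG; have [_ _ _ _ te] := ttau.
have FF : dle F F by move=> x; exact: lexx.
have := tf_homo DF DF DG eps0_in_Delta FF (Delta_le_eps0 DG).
by rewrite te.
Qed.

(** By [tf_le_left] the assumed inequality is already idempotency. *)
Lemma archimedean_le F : archimedean_tf tau -> in_Delta F ->
  dle F (tau F F) -> F = @eps0 R \/ F = @epsinf R.
Proof.
move=> ta DF FF; apply: ta => //; apply: dle_anti => //.
exact: tf_le_left.
Qed.

End TriangleFunction.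
End WeakConvergence.

(** * Convergent subsequences of coefficient vectors *)

Section Subsequences.
Context {R : realType}.

Lemma cvg_subseq_ge (u : nat -> R) (l : R) (f : nat -> nat) :
  (forall k, (k <= f k)%N) -> u @ \oo --> l -> (u \o f) @ \oo --> l.
Proof.
move=> fk ul; apply: cvg_comp ul => A [N _ NA].
by exists N => // k /= Nk; apply: NA => /=; exact: leq_trans Nk (fk k).
Qed.

(** Subsequences are extracted one coordinate at a time; each further extraction keeps the limits
    already obtained. *)
Lemma bolzano_weierstrass_ffun n (b : nat -> 'I_n -> R) (M : R) :
  (forall k i, `|b k i| <= M) ->
  exists (f : nat -> nat) (l : 'I_n -> R), (forall k, (k <= f k)%N) /\
    forall i, (fun k => b (f k) i) @ \oo --> l i.
Proof.
move=> bM.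
have [f [fk fc]] : exists f : nat -> nat, (forall k, (k <= f k)%N) /\
    forall i, i \in enum 'I_n -> cvgn (fun k => b (f k) i).
  elim: (enum 'I_n) => [|i r [f [fk fc]]]; first by exists id.
  have bu : bounded_fun (fun k => b (f k) i).
    by exists M; split; [exact: num_real|] => x Mx k _; apply: le_trans (ltW Mx).
  have [g gi gc] := bolzano_weierstrass bu.
  have gk k : (k <= g k)%N.
    elim: k => // k IH; apply: (leq_ltn_trans IH).
    by have := leW_mono gi k k.+1; rewrite !ltEnat/= ltnSn.
  exists (f \o g); split=> [k|j]; first exact: leq_trans (gk k) (fk _).
  rewrite inE => /predU1P[-> //|/fc/cvg_ex[l jl]].
  by apply/cvg_ex; exists l; exact: (cvg_subseq_ge gk jl).
exists f, (fun i => lim ((fun k => b (f k) i) @ \oo)); split => // i.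
by apply: fc; rewrite mem_enum.
Qed.

Lemma cvg_sum_norm n (b : nat -> 'I_n -> R) (l : 'I_n -> R) (t : R) :
  (forall i, (fun k => b k i) @ \oo --> l i) ->
  (forall k, \sum_(i < n) `|b k i| = t) -> \sum_(i < n) `|l i| = t.
Proof.
move=> bl bt.
have sl : (fun k => \sum_(i < n) `|b k i|) @ \oo --> \sum_(i < n) `|l i|.
  by apply: cvg_big => [|i _]; [exact: add_continuous|apply: cvg_norm].
have st : (fun k => \sum_(i < n) `|b k i|) @ \oo --> t.
  by rewrite (_ : (fun k => _) = fun=> t); [exact: cvg_cst|exact/funext].
exact: cvg_unique sl st.
Qed.

End Subsequences.

(** * Scaling of vectors in an Archimedean PN space *)

Section ArchimedeanPNSpace.
Context {R : realType} {V : lmodType R}.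
Variables (nu : V -> dfun R) (tau taus : dfun R -> dfun R -> dfun R).
Hypotheses (hPN : PN_space nu tau taus) (harch : archimedean_tf taus).
Hypothesis hninf : forall p, nu p <> (@epsinf R).
Implicit Types (p q w : V) (x y c e l a b t : R).

Lemma nu_in_Delta p : in_Delta (nu p).
Proof. by case: hPN. Qed.

Let DN := nu_in_Delta.
Let tt : triangle_function tau. Proof. by case: hPN => -[]. Qed.
Let ts : triangle_function taus. Proof. by case: hPN => -[]. Qed.

Lemma nu_eq_eps0 p : dle (@eps0 R) (nu p) -> p = 0.
Proof.
move=> ep; case: hPN => _ _ _ _ [N1 _ _ _]; apply/N1.
by apply: dle_anti => //; exact: Delta_le_eps0.
Qed.

Lemma nu_half_le p : dle (nu p) (taus (nu (2^-1 *: p)) (nu (2^-1 *: p))).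
Proof.
case: hPN => _ _ _ _ [_ _ _ N4].
have := N4 p 2^-1; rewrite (_ : 1 - 2^-1 = 2^-1); last by lra.
by apply; lra.
Qed.

(** (N4) combined with the fact that [taus] lies below its first argument. *)
Lemma nu_shrink_le p l : 0 <= l <= 1 -> dle (nu p) (nu (l *: p)).
Proof.
case: hPN => _ _ _ _ [_ _ _ N4] l01 x.
by apply: le_trans (N4 p l l01 x) _; exact: (tf_le_left ts).
Qed.

Lemma nu_scale_le p a b : `|a| <= `|b| -> dle (nu (b *: p)) (nu (a *: p)).
Proof.
have [->|b0] := eqVneq b 0.
  by rewrite normr0 normr_le0 => /eqP -> x; exact: lexx.
move=> ab; have [_ _ _ _ [_ N2 _ _]] := hPN.
have -> : nu (a *: p) = nu (`|a / b| *: (b *: p)).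
  rewrite scalerA; case: (ger0P (a / b)) => _.
    by rewrite divfK.
  by rewrite mulNr divfK// scaleNr N2.
by apply: nu_shrink_le; rewrite normr_ge0 normf_div ler_pdivrMr ?normr_gt0 ?mul1r.
Qed.

(* The supremum F of nu (2^-m p) satisfies F <= taus F F, so the Archimedean
   property forces it to be eps0. *)
Lemma nu_scale_cvg (lam : nat -> R) p :
  lam @ \oo --> (0 : R) -> weak_cvg (fun k => nu (lam k *: p)) (@eps0 R).
Proof.
move=> lam0; pose F x := sup (range (fun m => nu (2^-1 ^+ m *: p) x)).
have ub x : has_ubound (range (fun m => nu (2^-1 ^+ m *: p) x)).
  by exists 1 => _ [m _ <-]; exact: Delta_le1.
have Fge m x : nu (2^-1 ^+ m *: p) x <= F x by apply: ub_le_sup => //; exists m.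
have n0 x : range (fun m => nu (2^-1 ^+ m *: p) x) !=set0.
  by exists (nu (2^-1 ^+ 0 *: p) x); exists 0%N.
have Fle x c : (forall m, nu (2^-1 ^+ m *: p) x <= c) -> F x <= c.
  by move=> H; apply: ge_sup => // _ [m _ <-].
have Fadh x e : 0 < e -> exists m, F x - e < nu (2^-1 ^+ m *: p) x.
  move=> e0; have [_ [m _ <-]] := @sup_adherent _ _ _ e0 (conj (n0 x) (ub x)).
  by exists m.
have DF : in_Delta F.
  apply/in_DeltaP; split=> [x|x y xy|x e e0|].
  - rewrite (le_trans _ (Fge 0%N x)) ?Delta_ge0//=.
    by apply: Fle => m; exact: Delta_le1.
  - by apply: Fle => m; apply: le_trans (Fge m y); exact: Delta_homo.
  - have e20 : 0 < e / 2 by lra.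
    have [m Fm] := Fadh x _ e20.
    have [y yx my] := Delta_left (DN (2^-1 ^+ m *: p)) x e20.
    by exists y => //; have := Fge m y; lra.
  - apply/le_anti; rewrite (le_trans _ (Fge 0%N _)) ?Delta_ge0// andbT.
    by apply: Fle => m; rewrite Delta_le0.
have FF : dle F (taus F F).
  move=> x; apply: Fle => m; apply: (le_trans (nu_half_le _ x)).
  rewrite scalerA -exprS; apply: (tf_homo ts) => //.
have [F0|Finf] := archimedean_le ts harch DF FF; last first.
  case: (hninf (p := p)); apply: dle_anti => x.
    by rewrite -Finf; have := Fge 0%N x; rewrite expr0 scale1r.
  exact: Delta_ge0.
apply/weak_cvg_eps0P => // x e x0 e0.
(* One dyadic scale 2^-m already has value above 1 - e at x; eventually |lam k| < 2^-m, and smaller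
   scalars only increase [nu]. *)
have [m] := Fadh x _ e0; rewrite F0 /eps0 x0 => me.
have m0 : 0 < 2^-1 ^+ m :> R by rewrite exprn_gt0// invr_gt0.
move/cvgrPdist_lt : lam0 => /(_ _ m0); apply: filterS => k.
rewrite sub0r normrN => km; apply: (lt_le_trans me); apply: nu_scale_le.
by rewrite [leRHS]ger0_norm ltW.
Qed.

Let H_ w m := nu (2 ^+ m *: w).

(* The weak limit H of nu (2^m w) satisfies H <= taus H H, so the Archimedean
   property leaves only eps0 (forcing w = 0) and epsinf. *)
Lemma nu_double_bounded w y c : 0 < c ->
  (forall m, c <= nu (2 ^+ m *: w) y) -> w = 0.
Proof.
move=> c0 wc; have DHm m : in_Delta (H_ w m) by exact: DN.
pose I x := inf (range (fun m => H_ w m x)).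
have lb x : has_lbound (range (fun m => H_ w m x)).
  by exists 0 => _ [m _ <-]; exact: (Delta_ge0 (DHm _)).
have n0 x : range (fun m => H_ w m x) !=set0.
  by exists (H_ w 0%N x); exists 0%N.
have Ile m x : I x <= H_ w m x by apply: ge_inf => //; exists m.
have Ige x d : (forall m, d <= H_ w m x) -> d <= I x.
  by move=> dH; apply: lb_le_inf => // _ [m _ <-].
have Ihomo x z : x <= z -> I x <= I z.
  move=> xz; apply: Ige => m; apply: le_trans (Ile m x) _.
  exact: (Delta_homo (DHm _)).
(* The infimum I need not be left-continuous; H is its left-continuous regularization. *)
pose H x := sup [set I z | z in [set z | z < x]].
have ub x : has_ubound [set I z | z in [set z | z < x]].
  by exists (I x) => _ [z zx <-]; exact/Ihomo/ltW.
have n0' x : [set I z | z in [set z | z < x]] !=set0.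
  by exists (I (x - 1)); exists (x - 1) => //=; lra.
have HI x : H x <= I x.
  by apply: ge_sup => // _ [z zx <-]; exact/Ihomo/ltW.
have IH z x : z < x -> I z <= H x by move=> zx; apply: ub_le_sup => //; exists z.
have HH m x : H x <= H_ w m x by exact: le_trans (HI x) (Ile m x).
have I0 x : 0 <= I x by apply: Ige => m; exact: (Delta_ge0 (DHm _)).
have H0 x : 0 <= H x by apply: le_trans (IH (x - 1) x _) => //; lra.
have DH : in_Delta H.
  apply/in_DeltaP; split=> [x|x z xz|x e e0|].
  - by rewrite H0 (le_trans (HH 0%N x))// (Delta_le1 (DHm _)).
  - by apply: ge_sup => // _ [u ux <-]; apply: IH; exact: lt_le_trans xz.
  - have [_ [z zx <-] Iz] := @sup_adherent _ _ _ e0 (conj (n0' x) (ub x)).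
    have zx' : z < x by exact: zx.
    exists ((z + x) / 2); first by lra.
    by apply: (lt_le_trans Iz); apply: IH; lra.
  - by apply/le_anti; rewrite H0 andbT (le_trans (HH 0%N 0))// (Delta_le0 (DHm _)).
have Hdecr m k x : (m <= k)%N -> H_ w k x <= H_ w m x.
  move=> mk; apply: nu_scale_le; rewrite !normrX ler_weXn2l//.
  by rewrite ger0_norm// ler1n.
have HmH : weak_cvg (H_ w) H.
  apply/weak_cvgP => [m||x z e xz e0]; [exact: DN|exact: DH|].
  have [_ [m _ <-] mI] := @inf_adherent _ _ _ e0 (conj (n0 x) (lb x)).
  exists m => // k /= mk; split.
    apply: le_lt_trans (Hdecr _ _ x mk) _; apply: (lt_le_trans mI).
    by rewrite lerD2r IH.
  have := HH k x; have := Delta_homo (DN (2 ^+ k *: w)) (ltW xz).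
  by rewrite /H_; lra.
have HHH : dle H (taus H H).
  have [tD _ _ _ _] := ts.
  (* For large m, H z <= H_(m+1) z <= taus H_m H_m z < taus H H x + e by halving and continuity;
     left continuity of H then carries z up to x. *)
  move=> x; apply: (Delta_leP DH) => z zx; apply/ler_addgt0Pr => e e0.
  have [_ [_ sc] _ _ _] := hPN.
  have := sc _ _ _ _ (fun m => DN _) (fun m => DN _) DH DH HmH HmH.
  move/weak_cvgP => /(_ (fun m => tD _ _ (DN _) (DN _)) (tD _ _ DH DH)).
  move=> /(_ z x e zx e0) [m _ /(_ m (leqnn m)) [mK _]].
  apply: le_trans (HH m.+1 z) _; apply: le_trans (ltW mK).
  have := nu_half_le (2 ^+ m.+1 *: w) z.
  by rewrite scalerA (_ : 2^-1 * 2 ^+ m.+1 = 2 ^+ m)// exprS mulKf ?pnatr_eq0.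
have [H_eps|Hinf] := archimedean_le ts harch DH HHH.
  apply: nu_eq_eps0 => x; rewrite -H_eps.
  by have := HH 0%N x; rewrite /H_ expr0 scale1r.
(* The shift by 1 is needed because H x only sees I strictly to the left of x. *)
have : c <= H (y + 1).
  apply: (@le_trans _ _ (I y)); last by apply: IH; lra.
  by apply: Ige => m; exact: wc.
by rewrite Hinf /epsinf leNgt c0.
Qed.

(** * Linear combinations of finitely many vectors and compactness of the l1-sphere *)

Section FiniteFamily.
Variables (n : nat) (p : 'I_n -> V).

Definition lincomb (a : 'I_n -> R) : V := \sum_(i < n) a i *: p i.

(** Induction on the summands: (N3) and continuity of [tau] at ([eps0], [eps0]) add one term at a
    time. *)
Lemma nu_lincomb_cvg (d : nat -> 'I_n -> R) :
  (forall i, (fun k => d k i) @ \oo --> (0 : R)) ->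
  weak_cvg (fun k => nu (lincomb (d k))) (@eps0 R).
Proof.
move=> d0; rewrite /lincomb.
elim: (index_enum _) => [|i r IH].
  have [_ _ _ _ [N1 _ _ _]] := hPN.
  rewrite (_ : (fun k => _) = fun=> @eps0 R); first exact: weak_cvg_cst.
  by apply/funext => k; rewrite big_nil; exact/N1.
have [[[tD _ _ _ te] _] [tc _] _ _ [_ _ N3 _]] := hPN.
have := tc _ _ _ _ (fun k => DN _) (fun k => DN _) eps0_in_Delta eps0_in_Delta
  (nu_scale_cvg (p i) (d0 i)) IH.
rewrite te; last exact: eps0_in_Delta.
move=> /weak_cvg_eps0P => /(_ (fun k => tD _ _ (DN _) (DN _))) H.
apply/weak_cvg_eps0P => // x e x0 e0.
apply: filterS (H x e x0 e0) => k ek.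
by rewrite big_cons; exact: lt_le_trans (N3 _ _ x).
Qed.

(* Minorizing nu (b k) by a fixed step function replaces the uniform
   continuity of tau by its continuity at a single pair of arguments. *)
Lemma nu_lincomb_closed (b : nat -> 'I_n -> R) (l : 'I_n -> R) x y c :
  (forall i, (fun k => b k i) @ \oo --> l i) -> 0 <= x -> x < y ->
  0 <= c <= 1 ->
  (\forall k \near \oo, c <= nu (lincomb (b k)) x) -> c <= nu (lincomb l) y.
Proof.
move=> bl x0 xy c01 cb.
have DS := step_df_in_Delta x0 c01.
pose E k := nu (lincomb (fun i => l i - b k i)).
have E0 : weak_cvg E (@eps0 R).
  apply: nu_lincomb_cvg => i; rewrite -(subrr (l i)).
  by apply: cvgB; [exact: cvg_cst|exact: bl].
have [[[tD _ _ _ te] _] [tc _] _ _ [_ _ N3 _]] := hPN.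
have := tc _ _ _ _ (fun k => DS) (fun k => DN _) DS eps0_in_Delta
  (@weak_cvg_cst _ _) E0.
rewrite te// => /weak_cvgP => /(_ (fun k => tD _ _ DS (DN _)) DS) SE.
apply/ler_addgt0Pr => e e0.
(* At the midpoint the step function already equals c, and room remains up to y for the weak
   limit. *)
have zy : (x + y) / 2 < y by lra.
have [k [ck [_]]] := filter_ex (filterI cb (SE _ _ _ zy e0)).
rewrite {1}/step_df ifT; last by lra.
have bE : lincomb l = lincomb (b k) + lincomb (fun i => l i - b k i).
  by rewrite /lincomb -big_split/=; apply: eq_bigr => i _; rewrite -scalerDl subrKC.
have Sb : dle (step_df x c) (nu (lincomb (b k))).
  move=> z; rewrite /step_df; case: ltP => xz; last exact: Delta_ge0.
  by apply: (le_trans ck); apply: Delta_homo => //; exact: ltW.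
have EE : dle (E k) (E k) by move=> z; exact: lexx.
have := tf_homo tt DS (DN _) (DN _) (DN _) Sb EE y.
have := N3 (lincomb (b k)) (lincomb (fun i => l i - b k i)) y.
by rewrite -bE /E; lra.
Qed.

Lemma lincombZ t (a : 'I_n -> R) :
  lincomb (fun i => t * a i) = t *: lincomb a.
Proof.
by rewrite /lincomb scaler_sumr; apply: eq_bigr => i _; rewrite scalerA.
Qed.

Lemma sum_normZ t (a : 'I_n -> R) : 0 <= t ->
  \sum_(i < n) `|t * a i| = t * \sum_(i < n) `|a i|.
Proof.
by move=> t0; rewrite mulr_sumr; apply: eq_bigr => i _; rewrite normrM ger0_norm.
Qed.

Let norm_le_sum (a : 'I_n -> R) i : `|a i| <= \sum_(i < n) `|a i|.
Proof. by rewrite (bigD1 i)//= lerDl sumr_ge0. Qed.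

(** The number x is both the argument and, through [expR (- x)], the bound on the value, so one
    relation governs both the approach to [eps0] and that to [epsinf]. *)
Definition sphere_bound t x := forall a : 'I_n -> R,
  \sum_(i < n) `|a i| = t -> nu (lincomb a) x <= expR (- x).

Lemma not_sphere_bound t x : ~ sphere_bound t x ->
  exists a : 'I_n -> R,
    \sum_(i < n) `|a i| = t /\ expR (- x) < nu (lincomb a) x.
Proof.
move=> nP; apply: contrapT => nex; apply: nP => a at_.
by rewrite leNgt; apply/negP => lt; apply: nex; exists a.
Qed.

Lemma sphere_bound_down t x y :
  x <= y -> sphere_bound t y -> sphere_bound t x.
Proof.
move=> xy Pt a /Pt ay; apply: (@le_trans _ _ (nu (lincomb a) y)).
  exact: Delta_homo.
by apply: (le_trans ay); rewrite ler_expR lerN2.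
Qed.

(** The factor s / t <= 1 maps the sphere of radius t to that of radius s, and shrinking only
    increases [nu]. *)
Lemma sphere_bound_up s t x :
  0 < s -> s <= t -> sphere_bound s x -> sphere_bound t x.
Proof.
move=> s0 st Ps a at_; have t0 : 0 < t by exact: lt_le_trans st.
have st0 : 0 <= s / t by rewrite divr_ge0 ?ltW.
apply: le_trans (Ps (fun i => (s / t) * a i) _); last first.
  by rewrite sum_normZ// at_ divfK// gt_eqF.
rewrite lincombZ; apply: nu_shrink_le.
by rewrite st0 ler_pdivrMr// mul1r.
Qed.

Hypothesis hind : lin_indep p.

Let lincomb_neq0 (a : 'I_n -> R) t :
  0 < t -> \sum_(i < n) `|a i| = t -> lincomb a <> 0.
Proof.
move=> t0 at_ /hind a0; move: t0; rewrite -at_ big1 ?ltxx// => i _.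
by rewrite a0 normr0.
Qed.

(** Otherwise violators for x = 1 / (k + 1) accumulate at a point of the sphere whose [nu] is
    [eps0], hence at a vanishing combination, against independence. *)
Lemma sphere_bound_small t : 0 < t -> exists2 x, 0 < x & sphere_bound t x.
Proof.
move=> t0; apply: contrapT => nP.
have /choice[a Ha] : forall k : nat, exists a : 'I_n -> R,
    \sum_(i < n) `|a i| = t /\ expR (- k.+1%:R^-1) < nu (lincomb a) k.+1%:R^-1.
  by move=> k; apply: not_sphere_bound => Pk; apply: nP; exists k.+1%:R^-1.
have [|f [l [fk fl]]] := @bolzano_weierstrass_ffun _ _ a t.
  by move=> k i; rewrite -(Ha k).1.
have lt : \sum_(i < n) `|l i| = t.
  by apply: cvg_sum_norm fl _ => k; exact: (Ha _).1.
apply: (lincomb_neq0 t0 lt); apply: nu_eq_eps0 => y.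
rewrite /eps0; case: ltP => y0; last exact: Delta_ge0.
apply/ler_addgt0Pr => e e0.
(* This puts x below y and makes [expR (- x)] at least 1 - e. *)
pose x := Num.min (y / 2) e.
have x0 : 0 < x by rewrite /x lt_min e0; lra.
have xy : x < y by rewrite /x gt_min; apply/orP; left; lra.
have xe : x <= e by rewrite /x ge_min lexx orbT.
have c01 : 0 <= expR (- x) <= 1 by rewrite expR_ge0 expR_le1 oppr_le0 ltW.
have := nu_lincomb_closed fl (ltW x0) xy c01.
have nearx : \forall k \near \oo, expR (- x) <= nu (lincomb (a (f k))) x.
  near=> k.
  have kx : (f k).+1%:R^-1 <= x.
    rewrite invf_ple ?posrE ?ltr0n//.
    apply: (@le_trans _ _ k.+1%:R); last by rewrite ler_nat ltnS.
    apply: (@le_trans _ _ k%:R); last by rewrite ler_nat.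
    by near: k; exact: nbhs_infty_ger.
  have := (Ha (f k)).2 => fk1.
  apply: (@le_trans _ _ (nu (lincomb (a (f k))) (f k).+1%:R^-1)).
    by apply: le_trans (ltW fk1); rewrite ler_expR lerN2.
  exact: Delta_homo.
move=> /(_ nearx); have := expR_ge1Dx (- x); lra.
Unshelve. all: by end_near. Qed.

(** Otherwise violators of radius k + 1, rescaled to the unit sphere, accumulate at some l, and
    every 2^m l keeps value at least [expR (- x)] at x + 1; [nu_double_bounded] then makes the
    combination of l vanish. *)
Lemma sphere_bound_large x : 0 < x -> exists2 t, 0 < t & sphere_bound t x.
Proof.
move=> x0; apply: contrapT => nP.
have /choice[a Ha] : forall k : nat, exists a : 'I_n -> R,
    \sum_(i < n) `|a i| = k.+1%:R /\ expR (- x) < nu (lincomb a) x.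
  by move=> k; apply: not_sphere_bound => Pk; apply: nP; exists k.+1%:R.
pose b k i := k.+1%:R^-1 * a k i.
have b1 k : \sum_(i < n) `|b k i| = 1.
  by rewrite sum_normZ// (Ha k).1 mulVf// pnatr_eq0.
have [|f [l [fk fl]]] := @bolzano_weierstrass_ffun _ _ b 1.
  by move=> k i; rewrite -(b1 k).
have l1 : \sum_(i < n) `|l i| = 1.
  by apply: cvg_sum_norm fl _ => k; exact: b1.
apply: (lincomb_neq0 ltr01 l1).
apply: (@nu_double_bounded _ (x + 1) (expR (- x))); first exact: expR_gt0.
move=> m; rewrite -lincombZ.
have c01 : 0 <= expR (- x) <= 1 by rewrite expR_ge0 expR_le1 oppr_le0 ltW.
apply: (@nu_lincomb_closed (fun k i => 2 ^+ m * b (f k) i) _ x) => //.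
- by move=> i; apply: cvgM; [exact: cvg_cst|exact: fl].
- exact: ltW.
- by lra.
(* From this index on, 2^m / (f k + 1) <= 1, so 2^m times the rescaled vector is a shrinking of the
   original violator. *)
exists (2 ^ m)%N => // k /= mk; rewrite /b.
have -> : lincomb (fun i => 2 ^+ m * ((f k).+1%:R^-1 * a (f k) i)) =
    (2 ^+ m / (f k).+1%:R) *: lincomb (a (f k)).
  by rewrite -lincombZ; congr lincomb; apply/funext => i; rewrite mulrA.
apply: le_trans (ltW (Ha (f k)).2) _; apply: nu_shrink_le.
rewrite divr_ge0 ?exprn_ge0//= ler_pdivrMr ?ltr0n// mul1r -natrX ler_nat.
by rewrite (leq_trans mk)// (leq_trans (fk k)).
Qed.

End FiniteFamily.
End ArchimedeanPNSpace.

(** * Assembly of the dominating norm on the real line *)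

Theorem theorem15 (R : realType) (V : lmodType R) (nu : V -> dfun R)
  (tau taus : dfun R -> dfun R -> dfun R)
  (hPN : PN_space nu tau taus) (harch : archimedean_tf taus)
  (hninf : forall p, nu p <> (@epsinf R))
  (n : nat) (p : 'I_n -> V) (hind : lin_indep p) :
  exists (c : R) (nu' : R^o -> dfun R) (tau' taus' : dfun R -> dfun R -> dfun R),
    [/\ c != 0, PN_space nu' tau' taus', archimedean_tf taus',
        (forall x : R^o, nu' x <> (@epsinf R)) &
        forall a : 'I_n -> R,
          dle (nu (\sum_(i < n) a i *: p i)) (nu' (c * \sum_(i < n) `|a i|))].
Proof.
have DN := nu_in_Delta hPN.
have [h [k [hk h0 Ph]]] := @scaling_bijection R (sphere_bound nu p)
  (fun t x y _ _ => @sphere_bound_down _ _ _ _ _ hPN _ p t x y)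
  (fun s t x s0 st _ => @sphere_bound_up _ _ _ _ _ hPN _ p s t x s0 st)
  (@sphere_bound_small _ _ _ _ _ hPN harch hninf _ p hind)
  (@sphere_bound_large _ _ _ _ _ hPN harch hninf _ p hind).
have [hK kK hm] := hk.
have kh := increasing_bijectionC hk; have [_ _ km] := kh.
have k0 : k 0 = 0 by rewrite -{1}h0 hK.
have fg := exp_conj_bijection hk.
have f0 := exp_conj0 h; have f1 := exp_conj1 h0.
exists 1, (fun t => transport (exp_conj h) k (exp_norm t)).
exists (transport_tf (exp_conj h) (exp_conj k) k h tauP).
exists (transport_tf (exp_conj h) (exp_conj k) k h tauP).
split.
- exact: oner_neq0.
- exact: (transport_PN_space fg kh f0 f1 k0 exp_norm_PN_space).
- exact: (transport_archimedean fg kh f0 f1 k0 tauP_archimedean).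
- move=> t /(congr1 (transport (exp_conj k) h)).
  rewrite (transportK fg kh) transport_epsinf ?exp_conj0//.
  exact: exp_norm_neq_epsinf.
move=> a x; rewrite mul1r; set t := \sum_(i < n) `|a i|.
rewrite /transport /exp_norm -{1}k0 (leW_mono km).
have t0 : 0 <= t by exact: sumr_ge0.
case: ltP => x0; last by rewrite exp_conj0 (Delta_le0 (DN _)).
rewrite exp_conj_expR (ger0_norm t0).
(* For h t <= x the right-hand side is 1. Below h t, the bound at h t suffices because max(0, t - k
   x) <= t. *)
have [xt|tx] := ltP x (h t); last first.
  rewrite max_l; first by rewrite h0 oppr0 expR0; exact: Delta_le1.
  by rewrite subr_le0 -hm kK.
have tp : 0 < t by rewrite -(leW_mono hm) h0; exact: lt_trans xt.
apply: (@le_trans _ _ (nu (lincomb p a) (h t))).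
  by apply: (Delta_homo (DN _)); exact: ltW.
apply: (le_trans (Ph _ tp a erefl)).
by rewrite ler_expR lerN2 hm ge_max t0 gerBl -k0 km ltW.
Qed.
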